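(* Let $S = \mathbb{N}$ or $S = \mathbb{Z}$, and let $(X_i)_{i \in S}$ be a weakly stationary process of Bernoulli (i.e. $\{0,1\}$-valued) random variables that is negatively correlated, i.e. $\mathrm{cov}(X_i,X_j) \leq 0$ for all distinct $i,j \in S$. Then for every $i \in S$, $$\sum_{j \in S} |\mathrm{cov}(X_i,X_j)| \leq \frac{1}{2}.$$
   Context: A process $(X_i)_{i\in S}$ is weakly stationary if for every $k \in S$ one has $\mathbb{E}[X_i] = \mathbb{E}[X_{i+k}]$ for all $i \in S$ and $\mathrm{cov}(X_i,X_j) = \mathrm{cov}(X_{i+k},X_{j+k})$ for all $i,j \in S$. *)

(* Defs.v *)
From HB Require Import structures.
From mathcomp Require Import all_boot all_order all_algebra.
From mathcomp Require Import all_classical all_reals all_analysis.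

Set Implicit Arguments.
Unset Strict Implicit.
Unset Printing Implicit Defensive.

Import Order.TTheory GRing.Theory Num.Theory.

Local Open Scope classical_set_scope.
Local Open Scope ring_scope.

(* The index set S is an additive monoid, so that the shift i + k makes sense
   both for nat and for int. Expectations and covariances have values in
   \bar R; they are finite for {0,1}-valued random variables. *)

Definition zero_one_valued d (T : measurableType d) (R : realType)
    (P : probability T R) (S : Type) (X : S -> {RV P >-> R}) : Prop :=
  forall (i : S) (t : T), X i t = 0 \/ X i t = 1.

Definition weakly_stationary d (T : measurableType d) (R : realType)
    (P : probability T R) (S : nmodType) (X : S -> {RV P >-> R}) : Prop :=
  forall k : S,
    (forall i : S, 'E_P[X i] = 'E_P[X (i + k)%R])%E /\
    (forall i j : S,
       covariance P (X i) (X j) = covariance P (X (i + k)) (X (j + k))).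

Definition negatively_correlated d (T : measurableType d) (R : realType)
    (P : probability T R) (S : Type) (X : S -> {RV P >-> R}) : Prop :=
  forall i j : S, i <> j -> (covariance P (X i) (X j) <= 0)%E.

(* Main.v *)
(* Write c(k) = cov(X_0, X_k) and V(n) = Var(X_0 + ... + X_(n-1)) >= 0.  The
   increments V(n+1) - V(n) = c(0) + 2 (c(1) + ... + c(n)) are nonincreasing in
   n, since c(k) <= 0 for k >= 1; a nonnegative sequence with nonincreasing
   increments has nonnegative increments, so 2 (|c(1)| + |c(2)| + ...) <= c(0).
   As cov(X_i, X_j) = c(|i - j|), the two-sided sum of absolute covariances is
   at most 2 c(0) <= 1/2; over the naturals one sums fewer terms. *)

Require Import Defs.
From HB Require Import structures.
From mathcomp Require Import all_boot all_order all_algebra.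
From mathcomp Require Import all_classical all_reals all_analysis.
From mathcomp Require Import measurable_realfun.
From mathcomp Require Import zify lra.

Import Order.TTheory GRing.Theory Num.Theory.

Local Open Scope classical_set_scope.
Local Open Scope ring_scope.

(** A negative increment [u n] would bound all later ones from above, so [v] would fall below zero
    at least linearly after [n]. *)
Lemma concave_ge0_increment_ge0 (R : archiRealFieldType) (v u : nat -> R) :
  (forall n, 0 <= v n) -> (forall n, v n.+1 = v n + u n) ->
  (forall n, u n.+1 <= u n) -> forall n, 0 <= u n.
Proof.
move=> v0 vS uS n; rewrite leNgt; apply/negP => un0.
have un m : u (n + m)%N <= u n.
  by elim: m => [|m IH]; rewrite ?addn0// addnS (le_trans (uS _)).
have vm m : v (n + m)%N <= v n + u n *+ m.
  elim: m => [|m IH]; first by rewrite addn0 mulr0n addr0.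
  by rewrite addnS vS mulrSr addrA lerD.
(* By the Archimedean property, [m] steps of size [- u n] exceed the starting height [v n]. *)
pose m := Num.bound (v n / - u n).
have vnm : v n < - u n *+ m.
  rewrite -mulr_natl -ltr_pdivrMr ?oppr_gt0// archi_boundP//.
  by rewrite divr_ge0 ?v0// oppr_ge0 ltW.
have := le_trans (v0 _) (vm m).
by move: vnm; rewrite mulNrn; lra.
Qed.

Section esum_int.
Local Open Scope ereal_scope.

(** Cut the integers at [i]: the points [i + k] give the first series and the points [i - (k + 1)]
    the second, so the diagonal term [f 0] occurs only once. *)
Lemma esum_int_absz_sub (R : realType) (f : nat -> \bar R) (i : int) :
  (forall k, 0 <= f k) ->
  \esum_(j in [set: int]) f `|i - j|%N =
  \sum_(k <oo) f k + \sum_(k <oo) f k.+1.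
Proof.
move=> f0; rewrite (esumID [set j : int | (i <= j)%R])// !setTI.
congr (_ + _).
  rewrite (_ : [set j | _] = range (fun k : nat => (i + k%:Z)%R)).
    rewrite esum_image; last by move=> x y _ _; lia.
    rewrite nneseries_esumT//; apply: eq_esum => k _.
    by congr f; lia.
  apply/seteqP; split => [j /= ij|_ [k _ <-]] /=; last by lia.
  by exists `|i - j|%N => //; lia.
rewrite (_ : ~` _ = range (fun k : nat => (i - k.+1%:Z)%R)).
  rewrite esum_image; last by move=> x y _ _; lia.
  rewrite nneseries_esumT//; apply: eq_esum => k _.
  by congr f; lia.
apply/seteqP; split => [j /= ij|_ [k _ <-]] /=; last by lia.
by exists `|i - j|.-1%N => //; lia.
Qed.

End esum_int.

Section zero_one.
Context d (T : measurableType d) (R : realType) (P : probability T R).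
Variable X : {RV P >-> R}.
Hypothesis X01 : forall t, X t = 0 \/ X t = 1.

Lemma zero_one_Lfun2 : (X : T -> R) \in Lfun P 2%:E.
Proof.
rewrite inE; apply/andP; split; rewrite inE//=.
rewrite /finite_norm unlock poweR_lty//.
apply: (@le_lt_trans _ _ (\int[P]_x cst 1 x)%E).
  apply: ge0_le_integral => //=.
  - apply/measurable_EFinP.
    apply/(@measurableT_comp _ _ _ _ _ _ (fun x : R => x `^ 2)%R) => //.
    exact/measurableT_comp.
  - move=> t _ /=; rewrite lee_fin.
    by case: (X01 t) => ->; rewrite ?normr0 ?normr1 ?powR0 ?powR1// pnatr_eq0.
by rewrite integral_cst//= mul1e; move: (probability_setT P) => ->; rewrite ltry.
Qed.

(** Since [X ^+ 2 = X], the variance is [p - p ^+ 2 = 1 / 4 - (p - 1 / 2) ^+ 2] with [p] the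
    mean. *)
Lemma zero_one_variance_le : ('V_P[X] <= (1 / 4)%:E)%E.
Proof.
rewrite varianceE ?zero_one_Lfun2//.
have -> : ((X : T -> R) ^+ 2 = X)%R.
  apply/funext => t; rewrite expr2 [LHS]/(X t * X t).
  by case: (X01 t) => ->; [exact: mulr0|exact: mulr1].
have : ('E_P[X])%E \is a fin_num.
  apply/expectation_fin_num/(Lfun_subset12 _ zero_one_Lfun2).
  by rewrite fin_num_measure.
move=> /fineK <-; rewrite -EFin_expe -EFinB lee_fin.
set p := fine _.
have := sqr_ge0 (p - 1 / 2); nra.
Qed.

End zero_one.

Section stationary.
Context d (T : measurableType d) (R : realType) (P : probability T R).
Variables (X : nat -> T -> R) (c : nat -> R).
Hypothesis X2 : forall i, X i \in Lfun P 2%:E.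
Hypothesis covX : forall i j, (i <= j)%N ->
  covariance P (X i) (X j) = (c (j - i))%:E.

Lemma Lfun2_sum n : \sum_(i < n) X i \in Lfun P 2%:E.
Proof.
have le12 : (1 <= 2%:E :> \bar R)%E by rewrite lee1n.
by apply: rpred_sum => i _.
Qed.

Lemma covariance_suml n (Y : T -> R) : Y \in Lfun P 2%:E ->
  covariance P (\sum_(i < n) X i) Y = (\sum_(i < n) covariance P (X i) Y)%E.
Proof.
move=> Y2; elim: n => [|n IH]; first by rewrite !big_ord0 covariance_cst_l.
by rewrite !big_ord_recr/= covarianceDl ?Lfun2_sum// IH.
Qed.

Lemma variance_sum_recr n :
  ('V_P[(\sum_(i < n.+1) X i)%R] =
   'V_P[(\sum_(i < n) X i)%R] + (c 0%N + 2 * \sum_(k < n) c k.+1)%:E)%E.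
Proof.
rewrite big_ord_recr/= varianceD ?Lfun2_sum// covariance_suml//.
rewrite [X in (_ + X + _)%E]covX// subnn -addeA [in RHS](EFinD (c 0%N)) EFinM.
congr (_ + (_ + _ * _))%E.
rewrite (eq_bigr (fun i : 'I_n => (c (n - i))%:E)); last first.
  by move=> i _; rewrite covX // ltnW.
(* Reversal sends [i] to [n - 1 - i], turning the lag [n - i] into [i + 1]. *)
rewrite sumEFin (reindex_inj rev_ord_inj)/=; congr EFin.
by apply: eq_bigr => i _; congr c; have := ltn_ord i; lia.
Qed.

Lemma sum_covariance_le : (forall k, c k.+1 <= 0) ->
  forall n, 2 * \sum_(k < n) `|c k.+1| <= c 0%N.
Proof.
move=> c0 n.
have Vfin m : 'V_P[\sum_(i < m) X i] \is a fin_num.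
  by rewrite variance_fin_num ?Lfun2_sum.
have -> : \sum_(k < n) `|c k.+1| = - \sum_(k < n) c k.+1.
  by rewrite -sumrN; apply: eq_bigr => k _; rewrite ler0_norm.
(* The claim now says that the variance increment at [n] is nonnegative. *)
rewrite mulrN -subr_ge0 opprK.
apply: (@concave_ge0_increment_ge0 R (fun m => fine 'V_P[\sum_(i < m) X i])
  (fun m => c 0%N + 2 * \sum_(k < m) c k.+1)) => m.
- by rewrite fine_ge0 ?variance_ge0.
- by rewrite variance_sum_recr fineD.
- by rewrite lerD2l ler_pM2l// big_ord_recr/= gerDl.
Qed.

End stationary.

(** Serves both index sets: a process over the naturals already determines every covariance through
    the lag, while the sum runs over integer [j]. *)
Lemma esum_covariance_le (d : measure_display) (T : measurableType d)
    (R : realType) (P : probability T R) (X : nat -> {RV P >-> R}) (i : int) :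
  zero_one_valued X ->
  (forall m n, (m <= n)%N ->
     covariance P (X m) (X n) = covariance P (X 0%N) (X (n - m)%N)) ->
  negatively_correlated X ->
  (\esum_(j in [set: int]) `|covariance P (X 0%N) (X `|i - j|%N)|
     <= (1 / 2)%:E)%E.
Proof.
move=> X01 Xst Xneg.
have X2 n : (X n : T -> R) \in Lfun P 2%:E by apply: zero_one_Lfun2; exact: X01.
have Pfin : P setT \is a fin_num := fin_num_measure P _ measurableT.
have cfin n : covariance P (X 0%N) (X n) \is a fin_num.
  by apply: covariance_fin_num; [exact: Lfun_subset12..|exact: Lfun2_mul_Lfun1].
pose c n := fine (covariance P (X 0%N) (X n)).
have cE n : covariance P (X 0%N) (X n) = (c n)%:E by rewrite fineK.
have c0 k : c k.+1 <= 0 by rewrite -lee_fin -cE; exact: Xneg.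
have c0_ge0 : 0 <= c 0%N by rewrite -lee_fin -cE; exact: variance_ge0.
have c0_le : c 0%N <= 1 / 4.
  by rewrite -lee_fin -cE; exact: (zero_one_variance_le _ _ _ _ _ (X01 0%N)).
(* The uniform bound on partial sums passes to the limit. *)
have S_le : (\sum_(k <oo) `|(c k.+1)%:E| <= (c 0%N / 2)%:E)%E.
  apply: lime_le; first exact: is_cvg_nneseries.
  apply: nearW => n; rewrite big_mkord sumEFin lee_fin ler_pdivlMr// mulrC.
  apply: (@sum_covariance_le _ _ _ P (fun n => X n : T -> R)) => // j k jk.
  by rewrite Xst.
under eq_esum => j _ do rewrite cE.
rewrite (esum_int_absz_sub _ (fun k => `|(c k)%:E|%E))//.
rewrite nneseries_recl// abse_EFin ger0_norm//.
(* The diagonal term plus two tails: [2 * c 0 <= 2 * (1 / 4)]. *)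
apply: (@le_trans _ _ ((c 0%N)%:E + (c 0%N / 2)%:E + (c 0%N / 2)%:E)%E).
  rewrite -nneseries_addn//; under eq_eseriesr do rewrite addn1.
  by rewrite !leeD.
rewrite -!EFinD lee_fin; lra.
Qed.

Theorem mainTheorem4 (d : measure_display) (T : measurableType d)
    (R : realType) (P : probability T R) :
  (forall X : nat -> {RV P >-> R},
     zero_one_valued X -> weakly_stationary X -> negatively_correlated X ->
     forall i : nat,
       (\esum_(j in [set: nat]) `|covariance P (X i) (X j)| <= (1 / 2)%:E)%E) /\
  (forall X : int -> {RV P >-> R},
     zero_one_valued X -> weakly_stationary X -> negatively_correlated X ->
     forall i : int,
       (\esum_(j in [set: int]) `|covariance P (X i) (X j)| <= (1 / 2)%:E)%E).
Proof.
split=> X X01 Xst Xneg i.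
- have cE m n : (m <= n)%N ->
      covariance P (X m) (X n) = covariance P (X 0%N) (X (n - m)%N).
    move=> mn; rewrite (proj2 (Xst m) 0 (n - m)%N).
    by rewrite [(0 + m)%R]add0n [(_ + m)%R]subnK.
  apply: le_trans (esum_covariance_le _ _ _ _ _ i%:Z X01 cE Xneg).
  (* The one-sided sum is the part of the two-sided sum over nonnegative [j]; the other terms are
     nonnegative. *)
  apply: (@le_trans _ _ (\esum_(j in range Posz)
      `|covariance P (X 0%N) (X `|i%:Z - j|%N)|)%E).
    rewrite esum_image; last by move=> x y _ _ [].
    apply: le_esum => j _; have [ij|ji] := leqP i j.
      by rewrite cE//; have -> : `|i - j|%N = (j - i)%N by lia.
    rewrite covarianceC cE ?(ltnW ji)//.
    by have -> : `|i - j|%N = (i - j)%N by lia.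
  rewrite esum_mkcond; apply: le_esum => j _.
  by case: ifP => // _; exact: abse_ge0.
- have cE (m n : int) : (m <= n)%R ->
      covariance P (X m) (X n) = covariance P (X 0) (X `|n - m|%N%:Z).
    move=> mn; rewrite (proj2 (Xst m) 0 `|n - m|%N%:Z) add0r.
    by have -> : (`|n - m|%N%:Z + m)%R = n by lia.
  (* Restrict the process to nonnegative indices; by stationarity, the covariance at [i] and [j] is
     that of [X 0] with the variable at index [|i - j|]. *)
  apply: le_trans (esum_covariance_le _ _ _ _ (X \o Posz) i _ _ _).
  + apply: le_esum => j _ /=; have [ij|ji] := leP i j.
      by rewrite cE//; have -> : `|i - j|%N = `|j - i|%N by lia.
    by rewrite covarianceC cE ?(ltW ji).
  + by move=> n; exact: X01.
  + move=> m n mn /=; rewrite cE ?lez_nat//.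
    by have -> : `|n%:Z - m%:Z|%N = (n - m)%N by lia.
  + by move=> m n mn; apply: Xneg => -[].
Qed.
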